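(* Let $k\ge2$ be an integer. The set $\{\zeta^\diamondsuit(\boldsymbol{k})\mid\boldsymbol{k}\in\mathbb{I}^{\ge2}_k\}$ is a basis of the $\mathbb{Q}$-vector space $\mathcal{Z}^\diamondsuit_k$. In particular $\dim_{\mathbb{Q}}\mathcal{Z}^\diamondsuit_k=F_{k-1}$.
   Context: $[n]=\{1,\dots,n\}$. An index is a tuple of positive integers; admissible means nonempty with last entry $\ge2$. For a positive integer $N$ and an admissible index $\boldsymbol{k}=(k_1,\dots,k_r)$, let $[r]^1_{\boldsymbol{k}}=\{i\in[r]:k_i=1\}$ and for $A\subset[r]$ let $S_{r,N}(A)=\{(n_1,\dots,n_r)\in[N-1]^r: n_i\le n_{i+1}\text{ if } i\in A,\ n_i<n_{i+1}\text{ if } i\in[r-1]\setminus A\}$. Define \[ \zeta^\diamondsuit_N(\boldsymbol{k})=\sum_{A\subset[r]^1_{\boldsymbol{k}}}\ \sum_{(n_1,\dots,n_r)\in S_{r,N}(A)}\Bigl(\prod_{i\in A}\frac1{N-n_i}\Bigr)\Bigl(\prod_{i\in[r]\setminus A}\frac1{n_i^{k_i}}\Bigr)\in\mathbb{Q}, \] and $\zeta^\diamondsuit(\boldsymbol{k})=(\zeta^\diamondsuit_N(\boldsymbol{k}))_{N\ge1}\in\mathbb{Q}^{\mathbb{N}}$ (the $\mathbb{Q}$-vector space of rational sequences). $\mathcal{Z}^\diamondsuit_k=\operatorname{span}_{\mathbb{Q}}\{\zeta^\diamondsuit(\boldsymbol{k})\mid\boldsymbol{k}\text{ admissible of weight }k\}$.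 $\mathbb{I}^{\ge2}_k$ is the set of indices of weight $k$ with all entries $\ge2$. $F_n$ is the $n$th Fibonacci number ($F_1=F_2=1$). *)

(* Defs.v *)
From mathcomp Require Import all_boot all_order all_algebra.
Set Implicit Arguments. Unset Strict Implicit. Unset Printing Implicit Defensive.
Import Order.TTheory GRing.Theory Num.Theory.
Local Open Scope ring_scope.

(* An index is a seq nat; k_i (1-based in the paper) is nth 0 k (i-1). *)
Definition weight (k : seq nat) : nat := sumn k.

Definition admissible (k : seq nat) : bool :=
  [&& k != [::], all (fun x => 0 < x)%N k & (2 <= last 0%N k)%N].

Definition in_I2 (w : nat) (k : seq nat) : bool :=
  all (fun x => 2 <= x)%N k && (sumn k == w).

(* zeta^diamond_N(k).  Positions i : 'I_r are 0-based (paper's i+1);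
   n : 'I_r -> 'I_N with n i >= 1 encodes (n_1,...,n_r) in [N-1]^r;
   the condition for consecutive positions i, i+1 is <= if i in A, < otherwise. *)
Definition zetaN (k : seq nat) (N : nat) : rat :=
  \sum_(A : {set 'I_(size k)} | A \subset [set i : 'I_(size k) | nth 0%N k i == 1%N])
   \sum_(n : {ffun 'I_(size k) -> 'I_N} |
          [forall i : 'I_(size k), (0 < n i)%N] &&
          [forall i : 'I_(size k), forall j : 'I_(size k),
             (nat_of_ord j == (nat_of_ord i).+1) ==>
             (if i \in A then (n i <= n j)%N else (n i < n j)%N)])
     ((\prod_(i in A) ((N - n i)%:R)^-1) *
      (\prod_(i | i \notin A) (((n i)%:R) ^+ (nth 0%N k i))^-1)).

(* The sequence (zeta^diamond_N(k))_{N>=1}, shifted: entry m is the value at N = m+1. *)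
Definition zeta_seq (k : seq nat) : nat -> rat := fun m => zetaN k m.+1.

Definition in_span (B : seq (nat -> rat)) (f : nat -> rat) : Prop :=
  exists c : 'I_(size B) -> rat,
    forall m, f m = \sum_(i < size B) c i * nth (fun=> 0) B i m.

Definition lin_indep (B : seq (nat -> rat)) : Prop :=
  forall c : 'I_(size B) -> rat,
    (forall m, \sum_(i < size B) c i * nth (fun=> 0) B i m = 0) ->
    forall i, c i = 0.

Definition is_basis (B : seq (nat -> rat)) (V : (nat -> rat) -> Prop) : Prop :=
  [/\ (forall i : 'I_(size B), V (nth (fun=> 0) B i)),
      lin_indep B &
      (forall f, V f -> in_span B f)].

Definition has_dim (V : (nat -> rat) -> Prop) (d : nat) : Prop :=
  exists B, is_basis B V /\ size B = d.

Definition Zdiamond (w : nat) (f : nat -> rat) : Prop :=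
  exists L : seq (seq nat),
    (forall k, k \in L -> admissible k && (weight k == w)) /\
    in_span (map zeta_seq L) f.

Fixpoint fib (n : nat) : nat :=
  match n with
  | 0 => 0
  | 1 => 1
  | (m.+1 as p).+1 => fib p + fib m
  end.

(* Main.v *)
Require Import Defs.
From mathcomp Require Import all_boot all_order all_algebra.
From mathcomp Require Import ring zify.
Set Implicit Arguments. Unset Strict Implicit. Unset Printing Implicit Defensive.
Import Order.TTheory GRing.Theory Num.Theory.
Local Open Scope ring_scope.

(** Spanning: let [F_N(n)] be the truncation of [zeta^diamond_N(k)] at [n].  For
    [0 < n < N] there are [B] and [C], combinations of the
    [N^-a n^-j F_{k',N}(n)], such that
      [F_{N+1}(n) = F_N(n) + C/N^2 - (n/N) B/(N-n)] and
      [F_{N+1}(n+1) - F_{N+1}(n) = N B/(n(N-n))].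
    Evaluating at the endpoint, [zeta^diamond_{N+1}(k) - zeta^diamond_N(k)] is a
    combination of the [N^-a zeta^diamond_N(k')] with [a >= 2] and [k'] empty or
    admissible of weight [w - a].  By induction on the weight [k'] may be taken with
    all entries [>= 2], and then [N^-a zeta^diamond_N(k')] is the increment of
    [zeta^diamond_N(k', a)].

    Independence: on [I2] these are truncated multiple harmonic sums, and modulo a
    prime [p] one has [p^w zeta_n(k) = zeta_m(k)], where [n - 1] divided by [p] has
    quotient [m - 1 < p].  In the increment of a relation at [N = (M-1)p + 1] only the
    smallest last entry survives modulo [p], for every large [p]; this gives a
    relation of smaller weight at every [M]. *)

(** * Truncated sums and the comparison of [N] with [N+1] *)

(* [k] is the reversed index: its head is the last entry of the paper's index.
   At [n = N] the second sum contains the junk term [trunc k' N N / 0 = 0]. *)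
Fixpoint trunc (k : seq nat) (N n : nat) : rat :=
  if k is a :: k' then
    if a == 1%N then
      \sum_(1 <= m < n) trunc k' N m / m%:R + \sum_(1 <= m < n.+1) trunc k' N m / (N - m)%:R
    else \sum_(1 <= m < n) trunc k' N m / m%:R ^+ a
  else 1.

(** Prepending an entry 1 for [n < N]: by [1/m + 1/(N-m) = N/(m(N-m))] the two sums merge, and the
    term [m = n] is left over. A general [f] is allowed because the correction terms in
    [trunc_succN] pass through the same operator. *)
Definition E1 (f : nat -> nat -> rat) (N n : nat) : rat :=
  \sum_(1 <= m < n) f N m * (N%:R / (m%:R * (N - m)%:R)) + f N n / (N - n)%:R.

Definition Ea (a : nat) (f : nat -> nat -> rat) (N n : nat) : rat :=
  \sum_(1 <= m < n) f N m / m%:R ^+ a.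

Lemma natr_neq0 (N n : nat) : (0 < n < N)%N ->
  [/\ (n%:R : rat) != 0, (N%:R : rat) != 0, (N%:R - n%:R : rat) != 0 & (N - n)%:R = N%:R - n%:R :> rat].
Proof.
move=> /andP[n0 nN]; split; rewrite ?pnatr_eq0 -?lt0n //; first lia.
- by rewrite subr_eq0 eqr_nat; lia.
- by rewrite natrB // ltnW.
Qed.

Lemma trunc_cons1 k N n : (0 < n < N)%N -> trunc (1%N :: k) N n = E1 (trunc k) N n.
Proof.
move=> /andP[n0 nN] /=; rewrite big_nat_recr //= addrA -big_split /=; congr (_ + _).
rewrite !big_nat; apply: eq_bigr => m /andP[m0 mn].
have [] := @natr_neq0 N m; first by lia.
by move=> h1 h2 h3 ->; field; apply/andP.
Qed.

Lemma trunc_cons k a N n : (1 < a)%N -> trunc (a :: k) N n = Ea a (trunc k) N n.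
Proof. by case: a => [|[|a]]. Qed.

(* [s] is a lower bound for the exponent of [1/N]. *)
Inductive Mspan (s : nat) : nat -> (nat -> nat -> rat) -> Prop :=
| Mspan_gen a j k : (s <= a)%N -> all (leq 1) k ->
    Mspan s (a + j + sumn k) (fun N n => N%:R ^- a * (n%:R ^- j * trunc k N n))
| Mspan_0 w : Mspan s w (fun _ _ => 0)
| Mspan_add w f g : Mspan s w f -> Mspan s w g -> Mspan s w (fun N n => f N n + g N n)
| Mspan_scale w c f : Mspan s w f -> Mspan s w (fun N n => c * f N n)
| Mspan_ext w f g : (forall N n, (0 < n < N)%N -> g N n = f N n) -> Mspan s w f -> Mspan s w g.

Lemma Mspan_opp s w f : Mspan s w f -> Mspan s w (fun N n => - f N n).
Proof. by move=> /(Mspan_scale (-1)); apply: Mspan_ext => N n _; rewrite mulN1r. Qed.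

Lemma Mspan_sub s w f g : Mspan s w f -> Mspan s w g -> Mspan s w (fun N n => f N n - g N n).
Proof. by move=> hf /Mspan_opp hg; apply: Mspan_add. Qed.

Lemma Mspan_weaken s t w f : (t <= s)%N -> Mspan s w f -> Mspan t w f.
Proof.
move=> ts; elim=> {w f}.
- by move=> a j k sa kp; apply: Mspan_gen => //; apply: leq_trans sa.
- exact: Mspan_0.
- by move=> *; apply: Mspan_add.
- by move=> *; apply: Mspan_scale.
- by move=> w f g h _; apply: Mspan_ext.
Qed.

Lemma Mspan_divN e s w f : Mspan s w f -> Mspan (s + e) (w + e) (fun N n => N%:R ^- e * f N n).
Proof.
elim=> {w f}.
- move=> a j k sa kp.
  rewrite (_ : (a + j + sumn k + e = (a + e) + j + sumn k)%N); last by lia.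
  have sae : (s + e <= a + e)%N by rewrite leq_add2r.
  apply: Mspan_ext (Mspan_gen j sae kp) => N n _.
  by rewrite exprD invfM -!mulrA mulrCA.
- by move=> w; apply: Mspan_ext (Mspan_0 _ _) => N n _; rewrite mulr0.
- by move=> w f g _ hf _ hg; apply: Mspan_ext (Mspan_add hf hg) => N n _; rewrite mulrDr.
- by move=> w c f _ hf; apply: Mspan_ext (Mspan_scale c hf) => N n _; rewrite mulrCA.
- by move=> w f g h _; apply: Mspan_ext => N n /h ->.
Qed.

Lemma Mspan_divn e s w f : Mspan s w f -> Mspan s (w + e) (fun N n => n%:R ^- e * f N n).
Proof.
elim=> {w f}.
- move=> a j k sa kp.
  rewrite (_ : (a + j + sumn k + e = a + (j + e) + sumn k)%N); last by lia.
  apply: Mspan_ext (Mspan_gen _ sa kp) => N n _.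
  by rewrite (exprD _ j e) invfM -!mulrA mulrCA; congr (_ * _); rewrite mulrCA.
- by move=> w; apply: Mspan_ext (Mspan_0 _ _) => N n _; rewrite mulr0.
- by move=> w f g _ hf _ hg; apply: Mspan_ext (Mspan_add hf hg) => N n _; rewrite mulrDr.
- by move=> w c f _ hf; apply: Mspan_ext (Mspan_scale c hf) => N n _; rewrite mulrCA.
- by move=> w f g h _; apply: Mspan_ext => N n /h ->.
Qed.

Lemma Ea_gen a b j k N n :
  (1 < a)%N -> Ea a (fun N n => N%:R ^- b * (n%:R ^- j * trunc k N n)) N n = N%:R ^- b * trunc ((j + a)%N :: k) N n.
Proof.
move=> a1; rewrite trunc_cons; last by lia.
rewrite /Ea mulr_sumr; apply: eq_bigr => m _.
by rewrite exprD invfM; ring.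
Qed.

Lemma Mspan_Ea a s w f : (1 < a)%N -> Mspan s w f -> Mspan s (w + a) (Ea a f).
Proof.
move=> a1; elim=> {w f}.
- move=> b j k sb kp.
  rewrite (_ : (b + j + sumn k + a = b + 0 + sumn ((j + a)%N :: k))%N); last by rewrite /=; lia.
  have kp' : all (leq 1) ((j + a)%N :: k) by rewrite /= kp andbT; lia.
  apply: Mspan_ext (Mspan_gen 0 sb kp') => N n _.
  by rewrite Ea_gen // expr0 invr1 mul1r.
- move=> w; apply: Mspan_ext (Mspan_0 _ _) => N n _.
  by rewrite /Ea big1 // => *; rewrite mul0r.
- move=> w f g _ hf _ hg; apply: Mspan_ext (Mspan_add hf hg) => N n _.
  by rewrite /Ea -big_split; apply: eq_bigr => m _; rewrite mulrDl.
- move=> w c f _ hf; apply: Mspan_ext (Mspan_scale c hf) => N n _.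
  by rewrite /Ea mulr_sumr; apply: eq_bigr => m _; rewrite mulrA.
- move=> w f g h _; apply: Mspan_ext => N n nN; rewrite /Ea !big_nat.
  by apply: eq_bigr => m hm; rewrite h //; lia.
Qed.

Lemma E1_ext f g N n : (0 < n < N)%N -> (forall m, (0 < m < N)%N -> f N m = g N m) ->
  E1 f N n = E1 g N n.
Proof.
move=> nN h; rewrite /E1 h // !big_nat; congr (_ + _).
by apply: eq_bigr => m hm; rewrite h //; lia.
Qed.

Lemma E1_scale c f N n : E1 (fun N n => c N * f N n) N n = c N * E1 f N n.
Proof.
rewrite /E1 mulrDr mulr_sumr -mulrA; congr (_ + _).
by apply: eq_bigr => m _; rewrite mulrA.
Qed.

Lemma E1_add f g N n : E1 (fun N n => f N n + g N n) N n = E1 f N n + E1 g N n.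
Proof.
rewrite /E1 addrACA -big_split mulrDl /=; congr (_ + _).
by apply: eq_bigr => m _; rewrite mulrDl.
Qed.

(** Partial fractions: [N/(m^2(N-m)) = 1/m^2 + 1/(m(N-m))] inside the sum, and
    [1/(n(N-n)) = (1/n + 1/(N-n))/N] at the end point. *)
Lemma E1_divn f N n : (0 < n < N)%N ->
  E1 (fun N n => n%:R ^- 1 * f N n) N n =
  Ea 2 f N n + N%:R ^- 1 * E1 f N n + N%:R ^- 1 * (n%:R ^- 1 * f N n).
Proof.
move=> nN; rewrite /E1 /Ea mulrDr addrA mulr_sumr -big_split /= -addrA; congr (_ + _).
  rewrite !big_nat; apply: eq_bigr => m hm.
  have [] := @natr_neq0 N m; first by lia.
  by move=> h1 h2 h3 ->; field; rewrite h1 h2 h3.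
by have [h1 h2 h3 ->] := natr_neq0 nN; field; rewrite h1 h2 h3.
Qed.

(** Powers of [1/N] commute with [E1]. Each power of [1/n] is traded by [E1_divn] for an entry at
    least 2 or a factor [1/N], until [E1] meets a bare [trunc k] and prepends an entry 1. *)
Lemma Mspan_E1 s w f : Mspan s w f -> Mspan s w.+1 (E1 f).
Proof.
elim=> {w f}.
- move=> a j k sa kp.
  have gen0 i l : all (leq 1) l -> Mspan 0 (i + sumn l) (fun N n => n%:R ^- i * trunc l N n).
    move=> lp; apply: Mspan_ext (Mspan_gen i (leqnn 0) lp) => N n _.
    by rewrite expr0 invr1 mul1r.
  suff h : Mspan 0 (j + sumn k).+1 (E1 (fun N n => n%:R ^- j * trunc k N n)).
    have := Mspan_weaken sa (Mspan_divN a h).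
    rewrite (_ : ((j + sumn k).+1 + a = (a + j + sumn k).+1)%N); last by lia.
    by apply: Mspan_ext => N n _; rewrite (E1_scale (fun N => N%:R ^- a)).
  elim: j => [|j IH].
    have := gen0 0%N (1%N :: k) kp; apply: Mspan_ext => N n nN.
    rewrite trunc_cons1 // expr0 invr1 mul1r; apply: E1_ext => // m _.
    by rewrite /= ?expr0 ?invr1 ?mul1r.
  have e2 := Mspan_Ea (leqnn 2) (gen0 j k kp).
  have e1 := Mspan_weaken (leq0n _) (Mspan_divN 1 IH).
  have e0 := Mspan_weaken (leq0n _) (Mspan_divN 1 (Mspan_divn 1 (gen0 j k kp))).
  rewrite addn2 in e2; rewrite addn1 in e1; rewrite !addn1 in e0.
  apply: Mspan_ext (Mspan_add (Mspan_add e2 e1) e0) => N n nN.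
  rewrite -E1_divn //; apply: E1_ext => // m _.
  by rewrite exprS invfM mulrA.
- move=> w; apply: Mspan_ext (Mspan_0 _ _) => N n _.
  by rewrite /E1 mul0r addr0 big1 // => *; rewrite mul0r.
- by move=> w f g _ hf _ hg; apply: Mspan_ext (Mspan_add hf hg) => N n _; rewrite E1_add.
- move=> w c f _ hf; apply: Mspan_ext (Mspan_scale c hf) => N n _.
  by rewrite (E1_scale (fun _ => c)).
- by move=> w f g h _; apply: Mspan_ext => N n nN; apply: E1_ext => // m /h.
Qed.

Lemma Mspan_trunc k : all (leq 1) k -> Mspan 0 (sumn k) (trunc k).
Proof.
move=> kp; apply: Mspan_ext (Mspan_gen 0 (leqnn 0) kp) => N n _.
by rewrite !expr0 invr1 !mul1r.
Qed.

(* In the header's notation [b = B/N] and [c = C/N^2]. *)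
Lemma trunc_succN k : all (leq 1) k -> exists b c,
  [/\ Mspan 1 (sumn k) b, Mspan 2 (sumn k) c,
      forall N n, (0 < n < N)%N ->
        trunc k N.+1 n = trunc k N n + c N n - n%:R * b N n / (N - n)%:R
    & forall N n, (0 < n < N)%N ->
        trunc k N.+1 n.+1 - trunc k N.+1 n = b N n * N%:R * (N%:R / (n%:R * (N - n)%:R))].
Proof.
elim: k => [|a k IH].
  move=> _; exists (fun _ _ => 0), (fun _ _ => 0); split; try exact: Mspan_0.
    by move=> N n _ /=; rewrite mulr0 mul0r subr0 addr0.
  by move=> N n _ /=; rewrite subrr !mul0r.
case/andP=> a0 kp; have [b [c [hb hc G1 G2]]] := IH kp.
(* Writing [n/(N-n) = N/(N-n) - 1] in the first identity and collecting the terms without a pole at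
   [n = N] gives [A]. *)
pose A N n := trunc k N n + b N n + c N n.
have hA : Mspan 0 (sumn k) A.
  apply: Mspan_add (Mspan_weaken (leq0n _) hc).
  exact: Mspan_add (Mspan_trunc kp) (Mspan_weaken (leq0n _) hb).
have GA N n : (0 < n < N)%N -> trunc k N.+1 n = A N n - N%:R * b N n / (N - n)%:R.
  move=> nN; rewrite G1 // /A; have [h1 h2 h3 ->] := natr_neq0 nN; field; exact: h3.
case: (altP (a =P 1%N)) => [a1|an1].
  subst a.
  (* In the increment of the new sum in [n] the contributions of [b] cancel and [A N n] times
     [N/(n(N-n))] remains, which forces [A/N] as the new [b]. *)
  exists (fun N n => N%:R ^- 1 * A N n), (E1 c).
  have G2' N n : (0 < n < N)%N ->
      trunc (1%N :: k) N.+1 n.+1 - trunc (1%N :: k) N.+1 n = A N n * (N%:R / (n%:R * (N - n)%:R)).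
    move=> nN /=; have n0 : (0 < n)%N by lia.
    rewrite big_nat_recr //= [X in _ + X - _]big_nat_recr //= subSS.
    have -> x y z t : x + y + (z + t) - (x + z) = y + t :> rat by ring.
    have -> : trunc k N.+1 n.+1 = trunc k N.+1 n + b N n * N%:R * (N%:R / (n%:R * (N - n)%:R)).
      by rewrite -G2 // addrC subrK.
    rewrite GA //; have [h1 h2 h3 ->] := natr_neq0 nN.
    by field; rewrite h1 h3.
  split.
  - by rewrite [sumn _]addnC; apply: (Mspan_divN 1 hA).
  - exact: Mspan_E1.
  - move=> N n nN.
    have N0 : N%:R != 0 :> rat by have [] := natr_neq0 nN.
    have n0 : (0 < n)%N by lia.
    have tel (k' : seq nat) f : 
       (forall n, (0 < n < N)%N -> trunc k' N.+1 n.+1 - trunc k' N.+1 n = f n) ->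
       \sum_(1 <= m < n) f m = trunc k' N.+1 n - trunc k' N.+1 1.
      move=> h; rewrite -(@telescope_sumr _ 1 n (trunc k' N.+1)) // !big_nat.
      by apply: eq_bigr => m hm; rewrite h //; lia.
    (* By the second identity [E1] of [N b] telescopes, down to the starting value at [n = 1].
       Divided by [N], that value also starts the sum for [1 :: k], so it cancels the [E1 b]
       contained in [E1 A]. *)
    have eb : E1 (fun N n => N%:R * b N n) N n = A N n - trunc k N.+1 1.
      rewrite /E1 (tel k); last by move=> m mN; rewrite G2 // [X in X * _]mulrC.
      rewrite GA //; ring.
    have := tel _ _ (G2' N) => /eqP; rewrite eq_sym subr_eq => /eqP ->.
    have -> : trunc (1%N :: k) N.+1 1 = trunc k N.+1 1 / N%:R.
      by rewrite /= big_geq // add0r big_nat1 subSS subn0.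
    have eA : E1 A N n = trunc (1%N :: k) N n + E1 b N n + E1 c N n.
      by rewrite trunc_cons1 // -!E1_add.
    rewrite E1_scale in eb.
    have -> : trunc k N.+1 1 = A N n - N%:R * E1 b N n by rewrite eb; ring.
    move: eA; rewrite {1}/E1; have [h1 h2 h3 ->] := natr_neq0 nN => eA.
    have -> x y : x + y = (x + A N n / (N%:R - n%:R)) - A N n / (N%:R - n%:R) + y by ring.
    rewrite eA.
    by field; rewrite h2 h3.
  - move=> N n nN; rewrite G2' //; have [h1 h2 h3 ->] := natr_neq0 nN.
    by field; rewrite h1 h2 h3.
have a2 : (1 < a)%N by lia.
have [e ea] : exists e, a = e.+2 by exists (a - 2)%N; lia.
(* The new [b] is read off from the second identity: it expands
   [n^-(e+1) (A - N b/(N-n)) (N-n)/N^2]. The new [c] is what the first identity then leaves, the sum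
   of the terms [m^(1-a) b/(N-m)] being expressed through [E1]. *)
exists (fun N n => N%:R ^- 1 * (n%:R ^- e.+1 * A N n) - N%:R ^- 2 * (n%:R ^- e * A N n)
        - N%:R ^- 1 * (n%:R ^- e.+1 * b N n)).
exists (fun N n => Ea a c N n + N%:R ^- 2 * (n%:R ^- e * A N n)
       - N%:R ^- 1 * E1 (fun N n => n%:R ^- e * b N n) N n).
have hA2 : Mspan 2 (a + sumn k) (fun N n => N%:R ^- 2 * (n%:R ^- e * A N n)).
  have := Mspan_divN 2 (Mspan_divn e hA).
  by rewrite (_ : (sumn k + e + 2 = a + sumn k)%N) //; lia.
have F' N n : trunc (a :: k) N n = \sum_(1 <= m < n) trunc k N m / m%:R ^+ a by rewrite trunc_cons.
split.
- apply: Mspan_sub; first apply: Mspan_sub.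
  + have := Mspan_divN 1 (Mspan_divn e.+1 hA).
    by rewrite (_ : (sumn k + e.+1 + 1 = a + sumn k)%N) //; lia.
  + exact: Mspan_weaken hA2.
  + have := Mspan_weaken (isT : (1 <= 1 + 1)%N) (Mspan_divN 1 (Mspan_divn e.+1 hb)).
    by rewrite (_ : (sumn k + e.+1 + 1 = a + sumn k)%N) //; lia.
- apply: Mspan_sub; first apply: Mspan_add => //.
  + by rewrite [sumn _]addnC; apply: Mspan_Ea.
  + have := Mspan_divN 1 (Mspan_E1 (Mspan_divn e hb)).
    by rewrite (_ : ((sumn k + e).+1 + 1 = a + sumn k)%N) //; lia.
- move=> N n nN; rewrite [in LHS]F'.
  have -> : \sum_(1 <= m < n) trunc k N.+1 m / m%:R ^+ a = trunc (a :: k) N n + Ea a c N n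
     - N%:R^-1 * \sum_(1 <= m < n) m%:R ^- e * b N m * (N%:R / (m%:R * (N - m)%:R)).
    rewrite F' /Ea mulr_sumr -big_split /= -sumrB !big_nat; apply: eq_bigr => m hm.
    have mN : (0 < m < N)%N by lia.
    rewrite G1 // ea; have [h1 h2 h3 ->] := natr_neq0 mN.
    by rewrite !exprS; field; rewrite h1 h2 h3 expf_neq0.
  rewrite /E1 /A; have [h1 h2 h3 ->] := natr_neq0 nN.
  by rewrite !exprS !expr0; field; rewrite h1 h2 h3 expf_neq0.
- move=> N n nN; rewrite !F' big_nat_recr /=; last by lia.
  have -> (x y : rat) : x + y - x = y by ring.
  rewrite GA // ea; have [h1 h2 h3 ->] := natr_neq0 nN.
  by rewrite !exprS !expr0; field; rewrite h1 h2 h3 expf_neq0.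
Qed.

(** * Spanning by indices with entries at least 2 *)

Lemma trunc_indep k N N' n : all (leq 2) k -> trunc k N n = trunc k N' n.
Proof.
elim: k n => [|a k IH] n //= /andP[a2 ak]; rewrite ifN; last by lia.
by rewrite ifN; last lia; apply: eq_bigr => m _; rewrite (IH m ak).
Qed.

Inductive Sspan : nat -> (nat -> rat) -> Prop :=
| Sspan_gen k : all (leq 2) k -> Sspan (sumn k) (fun N => trunc k N N)
| Sspan_0 w : Sspan w (fun _ => 0)
| Sspan_add w f g : Sspan w f -> Sspan w g -> Sspan w (fun N => f N + g N)
| Sspan_scale w c f : Sspan w f -> Sspan w (fun N => c * f N)
| Sspan_ext w f g : (forall N, (0 < N)%N -> g N = f N) -> Sspan w f -> Sspan w g.

(** The normalisation [f 1 = 0] makes [f] recoverable from its increments, as [Dspan_Sspan]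
    requires. *)
Definition Dspan w (d : nat -> rat) := exists f,
  [/\ Sspan w f, f 1%N = 0 & forall N, (0 < N)%N -> f N.+1 - f N = d N].

Lemma Dspan_ext w f g : (forall N, (0 < N)%N -> g N = f N) -> Dspan w f -> Dspan w g.
Proof. by move=> h [F0 [h1 h2 h3]]; exists F0; split=> // N N0; rewrite h // h3. Qed.

Lemma Dspan_0 w : Dspan w (fun _ => 0).
Proof. by exists (fun _ => 0); split=> [|//|N _]; [exact: Sspan_0 | rewrite subrr]. Qed.

Lemma Dspan_add w f g : Dspan w f -> Dspan w g -> Dspan w (fun N => f N + g N).
Proof.
move=> [f' [f1 f2 f3]] [g' [g1 g2 g3]]; exists (fun N => f' N + g' N); split.
- exact: Sspan_add.
- by rewrite f2 g2 addr0.
- by move=> N N0; rewrite -f3 // -g3 //; ring.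
Qed.

Lemma Dspan_scale w c f : Dspan w f -> Dspan w (fun N => c * f N).
Proof.
move=> [f' [f1 f2 f3]]; exists (fun N => c * f' N); split.
- exact: Sspan_scale.
- by rewrite f2 mulr0.
- by move=> N N0; rewrite -f3 //; ring.
Qed.

(** With entries at least 2, [trunc k N m] is independent of [N], so passing from [N] to [N+1] in
    [trunc (a :: k) N N] only adds the term [m = N]. *)
Lemma Dspan_divN a w f : (1 < a)%N -> Sspan w f -> Dspan (a + w) (fun N => N%:R ^- a * f N).
Proof.
move=> a1; elim=> {w f}.
- move=> k k2; exists (fun N => trunc (a :: k) N N); split.
  + by apply: (@Sspan_gen (a :: k)); rewrite /= a1.
  + by rewrite trunc_cons // /Ea big_geq.
  + move=> N N0; rewrite !trunc_cons // /Ea big_nat_recr //= (trunc_indep N.+1 N) //.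
    have -> : \sum_(1 <= m < N) trunc k N.+1 m / m%:R ^+ a = \sum_(1 <= m < N) trunc k N m / m%:R ^+ a.
      by apply: eq_bigr => m _; rewrite (trunc_indep N.+1 N).
    by ring.
- by move=> w; apply: Dspan_ext (Dspan_0 _) => N _; rewrite mulr0.
- by move=> w f g _ hf _ hg; apply: Dspan_ext (Dspan_add hf hg) => N _; rewrite mulrDr.
- by move=> w c f _ hf; apply: Dspan_ext (Dspan_scale c hf) => N _; rewrite mulrCA.
- by move=> w f g h _; apply: Dspan_ext => N /h ->.
Qed.

Lemma Dspan_Sspan w f : f 1%N = 0 -> Dspan w (fun N => f N.+1 - f N) -> Sspan w f.
Proof.
move=> f1 [g [g1 g2 g3]]; apply: Sspan_ext g1; elim=> [|[|N] IH] // _; first by rewrite f1 g2.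
have := g3 N.+1 isT; rewrite IH // => /eqP; rewrite subr_eq subrK => /eqP ->.
by [].
Qed.

(** The induction hypothesis of [trunc_Sspan], named so that the lemmas on increments can take it as
    an argument. *)
Definition Sreduces w := forall a k, (1 < a)%N -> all (leq 1) k -> (a + sumn k < w)%N ->
  Sspan (a + sumn k) (fun N => trunc (a :: k) N N).

(** The lower bound 2 serves twice: the factor [N^-b] takes weight away from the remaining sum, so
    the induction hypothesis applies to it, and [b >= 2] lets [Dspan_divN] handle the product. *)
Lemma Dspan_Ea w a v f : Sreduces w -> (1 < a)%N -> (v + a <= w)%N -> Mspan 2 v f ->
  Dspan (v + a) (fun N => Ea a f N N).
Proof.
move=> IH a1 + h; elim: h => {v f}.
- move=> b j k b2 kp vw.
  apply: (@Dspan_ext _ (fun N => N%:R ^- b * trunc ((j + a)%N :: k) N N)) => [N _|].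
    by rewrite Ea_gen.
  rewrite (_ : (b + j + sumn k + a = b + (j + a + sumn k))%N); last by lia.
  by apply: Dspan_divN => //; apply: IH => //; lia.
- move=> v _; apply: Dspan_ext (Dspan_0 _) => N _.
  by rewrite /Ea big1 // => *; rewrite mul0r.
- move=> v f g _ hf _ hg vw; apply: Dspan_ext (Dspan_add (hf vw) (hg vw)) => N _.
  by rewrite /Ea -big_split; apply: eq_bigr => m _; rewrite mulrDl.
- move=> v c f _ hf vw; apply: Dspan_ext (Dspan_scale c (hf vw)) => N _.
  by rewrite /Ea mulr_sumr; apply: eq_bigr => m _; rewrite mulrA.
- move=> v f g h _ hf vw; apply: Dspan_ext (hf vw) => N N0.
  by rewrite /Ea !big_nat; apply: eq_bigr => m hm; rewrite h //; lia.
Qed.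

(** Induction on [e] by [m^-(e+1) - N^-(e+1) = N^-1 (m^-e - N^-e) + N^-1 m^-(e+1) (N-m)]. The last
    term cancels the denominator, and its [1/N] joins the one in [f] to reach the exponent 2 that
    [Dspan_Ea] asks for. *)
Lemma Dspan_divided_difference w e v f : Sreduces w -> (v + e + 2 <= w)%N -> Mspan 1 v f ->
  Dspan (v + e + 2) (fun N => \sum_(1 <= m < N)
    f N m * (m%:R^-1 * (m%:R ^- e - N%:R ^- e) / (N - m)%:R)).
Proof.
move=> IHw; elim: e v f => [|e IH] v f vw hf.
  apply: Dspan_ext (Dspan_0 _) => N _.
  by apply: big1 => m _; rewrite !expr0 subrr mulr0 mul0r mulr0.
have hf2 := Mspan_divN 1 hf.
have h1 : Dspan (v + e.+1 + 2) (fun N => \sum_(1 <= m < N)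
    (N%:R ^- 1 * f N m) * (m%:R^-1 * (m%:R ^- e - N%:R ^- e) / (N - m)%:R)).
  rewrite (_ : (v + e.+1 + 2 = v + 1 + e + 2)%N); last by lia.
  by apply: IH (Mspan_weaken (isT : (1 <= 1 + 1)%N) hf2); lia.
have h2 : Dspan (v + e.+1 + 2) (fun N => Ea e.+2 (fun N n => N%:R ^- 1 * f N n) N N).
  rewrite (_ : (v + e.+1 + 2 = v + 1 + e.+2)%N); last by lia.
  by apply: (Dspan_Ea IHw) hf2 => //; lia.
apply: Dspan_ext (Dspan_add h1 h2) => N N0.
rewrite /Ea -big_split /= !big_nat; apply: eq_bigr => m hm.
have [h3 h4 h5 ->] := @natr_neq0 N m ltac:(lia).
by rewrite !exprS expr0; field; rewrite h3 h4 h5 !expf_neq0.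
Qed.

(** At [n = 1] all summation variables equal 1, so a term survives only if all entries are 1, and
    then each entry contributes [1/N]. *)
Lemma trunc_start k : exists e : rat, forall N, (0 < N)%N -> trunc k N.+1 1 = e * N%:R ^- sumn k.
Proof.
elim: k => [|a k [e IH]].
  by exists 1 => N _; rewrite /= expr0 invr1 mulr1.
exists (if a == 1%N then e else 0) => N N0.
rewrite [trunc _ _ _]/= big_geq // big_nat1 subSS subn0 add0r.
case: eqP => [->|_]; last by rewrite big_geq // mul0r.
by rewrite IH // (_ : sumn (1%N :: k) = (sumn k).+1) // exprS invfM; ring.
Qed.

Lemma trunc_Sspan a k : (1 < a)%N -> all (leq 1) k ->
  Sspan (a + sumn k) (fun N => trunc (a :: k) N N).
Proof.
move: {2}(a + sumn k)%N (leqnn (a + sumn k)) => w.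
elim/ltn_ind: w a k => w IHw a k aw a1 kp.
have IH : Sreduces (a + sumn k).
  by move=> a' k' a1' kp' lt; apply: (IHw (a' + sumn k')%N) => //; lia.
have [b [c [hb hc G1 G2]]] := trunc_succN kp; have [e He] := trunc_start k.
apply: Dspan_Sspan; first by rewrite trunc_cons // /Ea big_geq.
have h1 := @Dspan_Ea _ a (sumn k) c IH a1 ltac:(lia) hc.
have h2 := @Dspan_divided_difference _ (a - 2)%N (sumn k) b IH ltac:(lia) hb.
(* The starting value of [trunc k] contributes a pure power of [1/N], which is the case of an empty
   remaining index. *)
have h3 : Dspan (a + sumn k) (fun N => e * (N%:R ^- (a + sumn k) * trunc [::] N N)).
  rewrite -{1}[(a + _)%N]addn0; apply: Dspan_scale; apply: Dspan_divN; first by lia.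
  exact: (@Sspan_gen [::]).
rewrite (_ : (sumn k + (a - 2) + 2 = a + sumn k)%N) in h2; last by lia.
rewrite (_ : (sumn k + a = a + sumn k)%N) in h1; last by lia.
apply: Dspan_ext (Dspan_add (Dspan_add h1 (Dspan_scale (-1) h2)) h3) => N N0.
have GN : trunc k N.+1 N = e * N%:R ^- sumn k
   + \sum_(1 <= m < N) b N m * N%:R * (N%:R / (m%:R * (N - m)%:R)).
  rewrite -He //; apply/eqP; rewrite addrC -subr_eq -telescope_sumr // !big_nat.
  by apply/eqP; apply: eq_bigr => m hm; rewrite G2 //; lia.
(* The correction to the old terms and the new term [m = N] both contain [b/(N-m)]. Together they
   give [-(b/m)(m^(2-a) - N^(2-a))/(N-m)], a divided difference. *)
have key : \sum_(1 <= m < N) trunc k N.+1 m / m%:R ^+ a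
     + (\sum_(1 <= m < N) b N m * N%:R * (N%:R / (m%:R * (N - m)%:R))) / N%:R ^+ a
   = \sum_(1 <= m < N) trunc k N m / m%:R ^+ a + Ea a c N N
     - \sum_(1 <= m < N) b N m * (m%:R^-1 * (m%:R ^- (a - 2) - N%:R ^- (a - 2)) / (N - m)%:R).
  rewrite /Ea mulr_suml -!big_split -sumrB /= !big_nat; apply: eq_bigr => m hm.
  have mN : (0 < m < N)%N by lia.
  have [d ->] : exists d, a = d.+2 by exists (a - 2)%N; lia.
  rewrite G1 // subn2 /=; have [h4 h5 h6 ->] := natr_neq0 mN.
  by rewrite !exprS; field; rewrite h4 h5 h6 !expf_neq0.
rewrite !trunc_cons // {1 2}/Ea big_nat_recr //= GN mulrDl.
by rewrite [X in X - _]addrCA key exprD invfM; ring.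
Qed.

(** * Linear independence *)

(** For a prime [p] this is the localisation of the integers at [p], and [pzero] is its maximal
    ideal; a congruence modulo [p] is stated as [pzero] of a difference. *)
Definition pint (p : nat) (x : rat) :=
  exists (d : nat) (z : int), ~~ (p %| d)%N /\ x * d%:R = z%:~R.
Definition pzero (p : nat) (x : rat) := exists2 y, pint p y & x = p%:R * y.

Section PIntegral.
Variable p : nat.
Hypothesis p_pr : prime p.

Lemma pint_int (z : int) : pint p z%:~R.
Proof.
exists 1%N, z; split; last by rewrite mulr1.
by rewrite dvdn1; case: p p_pr => [|[]].
Qed.

Lemma pint_nat (n : nat) : pint p n%:R.
Proof. exact: (pint_int n). Qed.

Lemma pint_add x y : pint p x -> pint p y -> pint p (x + y).
Proof.
move=> [d [z [pd xz]]] [d' [z' [pd' yz]]]; exists (d * d')%N, (z * d'%:Z + z' * d%:Z).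
rewrite Euclid_dvdM // negb_or pd pd'; split=> //.
by rewrite natrM rmorphD !rmorphM /= -xz -yz -!pmulrn; ring.
Qed.

Lemma pint_mul x y : pint p x -> pint p y -> pint p (x * y).
Proof.
move=> [d [z [pd xz]]] [d' [z' [pd' yz]]]; exists (d * d')%N, (z * z').
rewrite Euclid_dvdM // negb_or pd pd'; split=> //.
by rewrite natrM rmorphM /= -xz -yz; ring.
Qed.

Lemma pint_exp x n : pint p x -> pint p (x ^+ n).
Proof.
move=> hx; elim: n => [|n IH]; first exact: (pint_nat 1).
by rewrite exprS; apply: pint_mul.
Qed.

Lemma pint_inv n : ~~ (p %| n)%N -> pint p (n%:R^-1).
Proof.
move=> pn; exists n, 1; split=> //; rewrite mulVf // pnatr_eq0.
by apply: contraNneq pn => ->; rewrite dvdn0.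
Qed.

Lemma pzero_pint x : pzero p x -> pint p x.
Proof. by move=> [y hy ->]; apply: pint_mul (pint_nat p) hy. Qed.

Lemma pzero_0 : pzero p 0.
Proof. by exists 0; [exact: (pint_nat 0) | rewrite mulr0]. Qed.

Lemma pzero_add x y : pzero p x -> pzero p y -> pzero p (x + y).
Proof.
by move=> [x' hx ->] [y' hy ->]; exists (x' + y'); [exact: pint_add | rewrite mulrDr].
Qed.

Lemma pzero_mull x y : pint p x -> pzero p y -> pzero p (x * y).
Proof. by move=> hx [y' hy ->]; exists (x * y'); [exact: pint_mul | rewrite mulrCA]. Qed.

Lemma pzero_exp a : (0 < a)%N -> pzero p (p%:R ^+ a).
Proof.
by case: a => // a _; exists (p%:R ^+ a); [apply: pint_exp; apply: pint_nat | rewrite exprS].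
Qed.

(** * Truncated sums modulo [p] *)

Lemma trunc_recr a k N n : (1 < a)%N ->
  trunc (a :: k) N n.+2 = trunc (a :: k) N n.+1 + trunc k N n.+1 / n.+1%:R ^+ a.
Proof. by move=> a1; rewrite !trunc_cons // /Ea big_nat_recr. Qed.

Lemma pint_trunc k N n : all (leq 2) k -> (n <= p)%N -> pint p (trunc k N n).
Proof.
elim: k n => [|a k IH] n; first by move=> _ _; apply: (pint_nat 1).
case/andP=> a2 k2 np; rewrite trunc_cons // /Ea big_nat.
apply: (big_ind (pint p)); [exact: (pint_nat 0) | exact: pint_add |].
move=> m /andP[m0 mn]; apply: pint_mul; first by apply: IH => //; lia.
rewrite -exprVn; apply: pint_exp; apply: pint_inv.
by rewrite gtnNdvd //; lia.
Qed.

(** Distribute the power of [p] over the factors [1/m_i^(k_i)]. A factor with [m_i] prime to [p]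
    becomes divisible by [p]; the others become [1/(m_i/p)^(k_i)]. As [n < p^2], these quotients are
    below [p], so everything is integral. *)
Lemma trunc_cong_modp k N n : all (leq 2) k -> (n %/ p < p)%N ->
  pzero p (p%:R ^+ sumn k * trunc k N n.+1 - trunc k N (n %/ p).+1).
Proof.
have p0 : (0 < p)%N by exact: prime_gt0.
have p0' : p%:R != 0 :> rat by rewrite pnatr_eq0 -lt0n.
elim: k n => [|a k IH] n.
  by move=> _ _; rewrite expr0 mul1r subrr; exact: pzero_0.
case/andP=> a2 k2.
have Fk n' : (n' %/ p < p)%N -> pint p (p%:R ^+ sumn k * trunc k N n'.+1).
  move=> n'p; rewrite -(subrK (trunc k N (n' %/ p).+1) (_ * _)).
  by apply: pint_add (pzero_pint (IH _ k2 n'p)) (pint_trunc _ _ _).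
elim: n => [|n IHn].
  by rewrite div0n trunc_cons // /Ea big_geq // mulr0 subrr => _; exact: pzero_0.
rewrite divnS // => np.
have np' : (n %/ p < p)%N by lia.
rewrite trunc_recr // (_ : sumn (a :: k) = a + sumn k)%N //.
have := IHn np'; rewrite (_ : sumn (a :: k) = a + sumn k)%N // => h.
(* If [p] does not divide [n.+1], the quotient is unchanged and the new term keeps a factor [p^a].
   Otherwise the quotient grows by one and the new term is congruent to the one added to the
   quotient sum. *)
case: (boolP (p %| n.+1)%N) => [|pn]; last first.
  have -> : p%:R ^+ (a + sumn k) * (trunc (a :: k) N n.+1 + trunc k N n.+1 / n.+1%:R ^+ a)
       - trunc (a :: k) N (0 + n %/ p).+1 =
     (p%:R ^+ (a + sumn k) * trunc (a :: k) N n.+1 - trunc (a :: k) N (n %/ p).+1) +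
     (n.+1%:R^-1 ^+ a * (p%:R ^+ sumn k * trunc k N n.+1)) * p%:R ^+ a.
    by rewrite add0n exprVn exprD; ring.
  apply: pzero_add h (pzero_mull _ (pzero_exp _)); last by lia.
  by apply: pint_mul (pint_exp _ (pint_inv pn)) (Fk _ _).
move=> pn.
have el : n.+1 = ((n %/ p).+1 * p)%N by rewrite -{1}(divnK pn) divnS // pn.
rewrite pn in np.
have -> : p%:R ^+ (a + sumn k) * (trunc (a :: k) N n.+1 + trunc k N n.+1 / n.+1%:R ^+ a)
       - trunc (a :: k) N (1 + n %/ p).+1 =
     (p%:R ^+ (a + sumn k) * trunc (a :: k) N n.+1 - trunc (a :: k) N (n %/ p).+1) +
     ((n %/ p).+1%:R^-1 ^+ a * (p%:R ^+ sumn k * trunc k N n.+1 - trunc k N (n %/ p).+1)).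
  rewrite add1n trunc_recr //.
  have -> : (n.+1%:R : rat) = (n %/ p).+1%:R * p%:R by rewrite el natrM.
  have q0 : (n %/ p).+1%:R != 0 :> rat by rewrite pnatr_eq0.
  by rewrite exprD exprVn exprMn; field; rewrite !expf_neq0.
apply: pzero_add h (pzero_mull _ (IH _ k2 np')).
by apply/pint_exp/pint_inv; rewrite gtnNdvd.
Qed.

End PIntegral.

Lemma pint_large (x : rat) p : (`|denq x| < p)%N -> pint p x.
Proof.
move=> xp; exists `|denq x|%N, (numq x); split.
  by rewrite gtnNdvd // absz_gt0 denq_eq0.
rewrite -{1}[x]divq_num_den pmulrn absz_denq divfK //.
by rewrite intr_eq0 denq_eq0.
Qed.

(** A prime above the numerator of a nonzero [x] does not divide it. The bound [B] leaves room to
    avoid finitely many bad primes. *)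
Lemma pzero_all x B : (forall p, prime p -> (B < p)%N -> pzero p x) -> x = 0.
Proof.
move=> h; apply/eqP; apply/negPn/negP => x0.
have [p] := prime_above (maxn B `|numq x|); rewrite gtn_max => /andP[Bp xp] p_pr.
have [y [d [z [pd yz]]] xy] := h p p_pr Bp.
have dx0 : (denq x)%:~R != 0 :> rat by rewrite intr_eq0 denq_eq0.
have /intr_inj e : (numq x * d%:Z)%:~R = (p%:Z * z * denq x)%:~R :> rat.
  rewrite !rmorphM /= -yz -!pmulrn.
  have -> : (numq x)%:~R = x * (denq x)%:~R :> rat by rewrite -{2}[x]divq_num_den divfK.
  by rewrite xy; ring.
have : (p %| `|numq x| * d)%N.
  have := congr1 absz e; rewrite !abszM /= => ->.
  by rewrite -mulnA dvdn_mulr.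
rewrite Euclid_dvdM // (negbTE pd) orbF gtnNdvd //.
by rewrite absz_gt0 numq_eq0.
Qed.

(** Nested strong inductions, on the weight and then on the head [a]: coefficients with a smaller
    head already vanish, and those with head [a] satisfy a relation of weight [w - a]. *)
Lemma trunc_free w (L : seq (seq nat)) (c : seq nat -> rat) : uniq L ->
  (forall k, k \in L -> in_I2 w k) ->
  (forall N, (0 < N)%N -> \sum_(k <- L) c k * trunc k N N = 0) ->
  forall k, k \in L -> c k = 0.
Proof.
elim/ltn_ind: w L c => w IH L c uL Lw rel.
have [w0|w0] := posnP w.
  move=> k kL; have := rel 1%N isT.
  have nilP k' : k' \in L -> k' = [::].
    move=> /Lw /andP[k2 /eqP]; case: k' k2 => [|a k'] //= /andP[a2 _]; lia.
  rewrite (bigD1_seq k) //= big_seq_cond big1 => [|k' /andP[/nilP -> ]].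
    by rewrite (nilP k kL) /= mulr1 addr0.
  by rewrite (nilP k kL) eqxx.
have consP k : k \in L -> exists a k', [/\ k = a :: k', (1 < a)%N, all (leq 2) k' & (w = a + sumn k')%N].
  move=> /Lw /andP[k2 /eqP]; case: k k2 => [|a k'] //=; first by lia.
  by move=> /andP[a2 k2] <-; exists a, k'.
have rel1 N : (0 < N)%N -> \sum_(k <- L) c k * (trunc (behead k) N N / N%:R ^+ head 0%N k) = 0.
  move=> N0; have : \sum_(k <- L) c k * trunc k N.+1 N.+1 - \sum_(k <- L) c k * trunc k N N = 0.
    by rewrite !rel // subrr.
  rewrite -sumrB => e; apply: etrans e; rewrite !big_seq.
  apply: eq_bigr => k /consP [a [k' [-> a2 k2 _]]].
  case: N N0 => // N _.
  have k2' : all (leq 2) (a :: k') by rewrite /= a2.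
  by rewrite [behead _]/= [head _ _]/= (trunc_indep N.+2 N.+1) // trunc_recr //; ring.
suff main a k : k \in L -> head 0%N k = a -> c k = 0 by move=> k kL; apply: main kL erefl.
elim/ltn_ind: a k => a IHa k kL ka.
have aw : (a <= w)%N by have [a' [k' [ek _ _ ->]]] := consP _ kL; rewrite -ka ek leq_addr.
have a1 : (1 < a)%N by have [a' [k' [ek a2 _ _]]] := consP _ kL; rewrite -ka ek.
pose La := [seq k' <- L | head 0%N k' == a].
have kE k' : k' \in La -> k' = a :: behead k'.
  by rewrite mem_filter => /andP[/eqP ea /consP [a' [k'' [e' _ _ _]]]]; rewrite -ea e'.
have relM M : (0 < M)%N -> \sum_(k <- La) c k * trunc (behead k) M M = 0.
  case: M => // M _; rewrite big_filter.
  (* Beyond this bound [p] makes all coefficients integral and exceeds the quotient [M]. *)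
  apply: (@pzero_all _ (maxn M.+1 (\max_(k' <- L) `|denq (c k')|))) => p p_pr.
  rewrite gtn_max => /andP[Mp dp].
  have cint k' : k' \in L -> pint p (c k').
    move=> k'L; apply: pint_large; apply: leq_ltn_trans dp.
    by rewrite (big_rem k') //= leq_maxl.
  (* After the case split the truncation point is [M.+1]. The increment relation is used at
     [n.+1 = M p + 1], which is prime to [p], while [n] has quotient [M]. *)
  pose n := (M * p)%N.
  have pn : ~~ (p %| n.+1)%N.
    by rewrite /n -addn1 dvdn_addr ?dvdn_mull // dvdn1; case: (p) p_pr => [|[]].
  have np : (n %/ p = M)%N by rewrite /n mulnK // prime_gt0.
  have np' : (n %/ p < p)%N by rewrite np; lia.
  have n0 : n.+1%:R != 0 :> rat by rewrite pnatr_eq0.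
  set x := \sum_(k <- L | _) _.
  suff : pzero p (n.+1%:R^-1 ^+ a * x).
    move=> h; rewrite (_ : x = n.+1%:R ^+ a * (n.+1%:R^-1 ^+ a * x)).
      by apply: pzero_mull => //; apply: pint_exp => //; apply: pint_nat.
    by rewrite exprVn mulVKf // expf_neq0.
  (* The subtracted sum is zero by [rel1] and is inserted for a termwise comparison. A head [b > a]
     leaves a factor [p^(b-a)], and [b = a] is settled by [trunc_cong_modp]. *)
  have -> : n.+1%:R^-1 ^+ a * x =
     \sum_(k <- L) (if head 0%N k == a then n.+1%:R^-1 ^+ a * (c k * trunc (behead k) M.+1 M.+1) else 0)
     + (-1) * (p%:R ^+ (w - a) * \sum_(k <- L) c k * (trunc (behead k) n.+1 n.+1 / n.+1%:R ^+ head 0%N k)).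
    by rewrite rel1 // !mulr0 addr0 -big_mkcond /= mulr_sumr.
  rewrite !mulr_sumr -big_split /= big_seq.
  apply: (big_ind (pzero p)); [exact: pzero_0 | exact: pzero_add |].
  move=> k' k'L; have [b [k'' [ek b2 k2 ew]]] := consP _ k'L; rewrite ek /=.
  have inv b' : pint p (n.+1%:R^-1 ^+ b') by apply: pint_exp => //; apply: pint_inv.
  have cg := trunc_cong_modp p_pr n.+1 k2 np'; rewrite np in cg.
  case: ltngtP => ba.
  - rewrite -ek (IHa b) ?ek //; last by rewrite -ek.
    by rewrite mul0r !mulr0 addr0; apply: pzero_0.
  - rewrite (_ : (w - a = sumn k'' + (b - a))%N); last by lia.
    rewrite exprD (_ : _ + _ = (- 1%:~R) * (c (b :: k'') * n.+1%:R^-1 ^+ b *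
        (p%:R ^+ sumn k'' * trunc k'' n.+1 n.+1)) * p%:R ^+ (b - a)); last by rewrite exprVn; ring.
    apply: pzero_mull => //; last by apply: pzero_exp => //; lia.
    rewrite -rmorphN; apply: pint_mul => //; first exact: pint_int.
    apply: pint_mul => //; first by apply: pint_mul => //; rewrite -ek; apply: cint.
    rewrite -(subrK (trunc k'' n.+1 M.+1) (_ * _)).
    by apply: pint_add => //; [apply: pzero_pint | apply: pint_trunc => //; lia].
  - subst b; rewrite (_ : (w - a = sumn k'')%N); last by lia.
    rewrite (trunc_indep M.+1 n.+1) //.
    rewrite (_ : _ + _ = (- 1%:~R) * (c (a :: k'') * n.+1%:R^-1 ^+ a) *
      (p%:R ^+ sumn k'' * trunc k'' n.+1 n.+1 - trunc k'' n.+1 M.+1)); last by rewrite exprVn; ring.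
    apply: pzero_mull => //.
    rewrite -rmorphN; apply: pint_mul => //; first exact: pint_int.
    by apply: pint_mul => //; rewrite -ek; apply: cint.
have kLa : k \in La by rewrite mem_filter ka eqxx.
rewrite (kE k kLa).
apply: (IH (w - a)%N _ (map behead La) (fun k' => c (a :: k'))).
- by lia.
- rewrite map_inj_in_uniq ?filter_uniq // => k1 k2 /kE e1 /kE e2 e.
  by rewrite e1 e2 e.
- move=> _ /mapP [k' k'La ->]; have := kE _ k'La.
  move: k'La; rewrite mem_filter => /andP[_ /consP [b [k'' [-> b2 k2 ew]]]] [ba].
  by rewrite /in_I2 /= k2 /=; lia.
- move=> N N0; rewrite big_map; apply: etrans (relM N N0); rewrite !big_seq.
  by apply: eq_bigr => k' /kE <-.
- exact: map_f.
Qed.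

(** * Recursive evaluation of [zetaN] *)

Lemma forall_andb (T : finType) (P Q : pred T) :
  [forall i, P i && Q i] = [forall i, P i] && [forall i, Q i].
Proof.
apply/forallP/andP => [h|[/forallP hP /forallP hQ] i]; last by rewrite hP hQ.
by split; apply/forallP => i; case/andP: (h i).
Qed.

Lemma forall_ord_recr r (P : pred 'I_r.+1) :
  [forall i, P i] = [forall j, P (lift ord_max j)] && P ord_max.
Proof.
apply/forallP/andP => [h|[/forallP h h0] i].
  by split=> //; apply/forallP => j.
by case: (unliftP ord_max i) => [j|] ->.
Qed.

Definition ffun_rcons (T : Type) r (h : {ffun 'I_r -> T}) (x : T) : {ffun 'I_r.+1 -> T} :=
  [ffun i => oapp h x (unlift ord_max i)].

Lemma ffun_rcons_lift (T : Type) r (h : {ffun 'I_r -> T}) x j :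
  ffun_rcons h x (lift ord_max j) = h j.
Proof. by rewrite ffunE liftK. Qed.

Lemma ffun_rcons_max (T : Type) r (h : {ffun 'I_r -> T}) x : ffun_rcons h x ord_max = x.
Proof. by rewrite ffunE unlift_none. Qed.

Lemma sum_ffun_recr (T : finType) r (G : {ffun 'I_r.+1 -> T} -> rat) :
  \sum_h G h = \sum_x \sum_h G (ffun_rcons h x).
Proof.
rewrite pair_bigA /= (reindex (fun p : T * {ffun 'I_r -> T} => ffun_rcons p.2 p.1)) //=.
exists (fun h => (h ord_max, [ffun j => h (lift ord_max j)])) => [[x h] _|h _] /=.
  rewrite ffun_rcons_max; congr (_, _); apply/ffunP => j.
  by rewrite ffunE ffun_rcons_lift.
apply/ffunP => i; case: (unliftP ord_max i) => [j|] ->.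
  by rewrite ffun_rcons_lift ffunE.
by rewrite ffun_rcons_max.
Qed.

(* The pair (b, m) attached to a position records membership in A and the value n_i. *)
Definition step (x : bool * nat) (n : nat) : bool := if x.1 then (x.2 <= n)%N else (x.2 < n)%N.

(** The value 0 for a marked entry other than 1 replaces the condition on [A], so that the sum can
    run over all functions. *)
Definition coef (k N : nat) (x : bool * nat) : rat :=
  if x.1 then (if k == 1%N then (N - x.2)%:R^-1 else 0) else (x.2%:R ^+ k)^-1.

(** The last condition treats [n] as a value following the last position. Removing that position
    leaves a chain bounded by the removed value, which is the recursion of [trunc]. *)
Definition chain N r (h : {ffun 'I_r -> bool * 'I_N}) (n : nat) : bool :=
  [&& [forall i, 0 < (h i).2]%N,
      [forall i : 'I_r, forall j : 'I_r,
         (nat_of_ord j == i.+1) ==> step ((h i).1, nat_of_ord (h i).2) (h j).2]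
    & [forall i : 'I_r, (i.+1 == r) ==> step ((h i).1, nat_of_ord (h i).2) n]].

Definition chain_sum (kk : nat -> nat) N r n : rat :=
  \sum_(h : {ffun 'I_r -> bool * 'I_N})
    (chain h n)%:R * \prod_(i < r) coef (kk i) N ((h i).1, nat_of_ord (h i).2).

Lemma chain_rcons N r (h : {ffun 'I_r -> bool * 'I_N}) x n :
  chain (ffun_rcons h x) n =
  [&& (0 < x.2)%N, step (x.1, nat_of_ord x.2) n & chain h x.2].
Proof.
rewrite /chain !forall_ord_recr /= !ffun_rcons_max.
have -> : [forall j, 0 < (ffun_rcons h x (lift ord_max j)).2]%N = [forall j, 0 < (h j).2]%N.
  by apply: eq_forallb => j; rewrite ffun_rcons_lift.
rewrite (_ : [forall j : 'I_r, ((lift ord_max j).+1 == r.+1) ==> _] = true); last first.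
  by apply/forallP => j; rewrite lift_max eqSS ltn_eqF.
rewrite (_ : [forall j : 'I_r, (nat_of_ord (lift ord_max j) == r.+1) ==> _] = true); last first.
  by apply/forallP => j; rewrite lift_max ltn_eqF // ltnS ltnW.
rewrite (ltn_eqF (ltnSn r)).
have -> : [forall i : 'I_r, forall j : 'I_r.+1,
       (nat_of_ord j == (lift ord_max i).+1) ==>
         step ((ffun_rcons h x (lift ord_max i)).1,
           nat_of_ord (ffun_rcons h x (lift ord_max i)).2) (ffun_rcons h x j).2] =
   [forall i : 'I_r, forall j : 'I_r,
         (nat_of_ord j == i.+1) ==> step ((h i).1, nat_of_ord (h i).2) (h j).2]
   && [forall i : 'I_r, (i.+1 == r) ==> step ((h i).1, nat_of_ord (h i).2) x.2].
  rewrite -forall_andb; apply: eq_forallb => i.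
  rewrite forall_ord_recr ffun_rcons_max ffun_rcons_lift lift_max [ord_max == _ :> nat]eq_sym.
  congr (_ && _); apply: eq_forallb => j.
  by rewrite ffun_rcons_lift lift_max.
rewrite eqxx /= !andbT.
by do ![case: (boolP [forall i, _]) => _; rewrite ?andbF ?andbT //=];
  case: (0 < x.2)%N => //=; case: (step _ _).
Qed.

Lemma chain_sum_recr kk N r n :
  chain_sum kk N r.+1 n = \sum_(x : bool * 'I_N)
    ((0 < x.2)%N && step (x.1, nat_of_ord x.2) n)%:R *
      (coef (kk r) N (x.1, nat_of_ord x.2) * chain_sum kk N r x.2).
Proof.
rewrite /chain_sum sum_ffun_recr; apply: eq_bigr => x _.
rewrite !mulr_sumr; apply: eq_bigr => h _.
rewrite chain_rcons andbA -mulnb natrM big_ord_recr /= ffun_rcons_max.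
rewrite (eq_bigr (fun i : 'I_r => coef (kk i) N ((h i).1, nat_of_ord (h i).2))); first by ring.
move=> i _; rewrite (_ : widen_ord _ i = lift ord_max i) ?ffun_rcons_lift //.
by apply/val_inj/esym; exact: lift_max.
Qed.

Lemma sum_indicator N (P : pred nat) (G : nat -> rat) a b : (b <= N)%N ->
  (forall m, (m < N)%N -> P m = (a <= m < b)%N) ->
  \sum_(m < N) (P m)%:R * G m = \sum_(a <= m < b) G m.
Proof.
move=> bN hP; rewrite -(big_mkord xpredT (fun m => (P m)%:R * G m)).
rewrite [RHS]big_geq_mkord (big_ord_widen_cond N (fun i => a <= i)%N) // big_mkord.
rewrite [RHS]big_mkcond; apply: eq_bigr => m _.
by rewrite hP //; case: ifP => _; rewrite ?mul1r ?mul0r.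
Qed.

Lemma chain_sum_trunc kk N r n : (0 < N)%N -> (n <= N)%N ->
  chain_sum kk N r n = trunc (rev (mkseq kk r)) N n.
Proof.
move=> N0; elim: r n => [|r IH] n nN.
  rewrite /chain_sum /= (big_pred1 [ffun i : 'I_0 => (true, Ordinal N0)]) => [|h]; last first.
    by apply/esym/eqP/ffunP => -[].
  rewrite big_ord0 mulr1 /chain (_ : [&& _, _ & _] = true) //.
  by apply/and3P; split; apply/forallP => -[].
rewrite chain_sum_recr mkseqS rev_rcons.
rewrite -(pair_bigA _ (fun b m => ((0 < (m : 'I_N))%N && step (b, nat_of_ord m) n)%:R *
      (coef (kk r) N (b, nat_of_ord m) * chain_sum kk N r m))) big_bool /=.
rewrite (@sum_indicator N (fun m => (0 < m)%N && step (false, m) n)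
     (fun m => coef (kk r) N (false, m) * chain_sum kk N r m) 1 n) //.
have -> : \sum_(1 <= m < n) coef (kk r) N (false, m) * chain_sum kk N r m =
   \sum_(1 <= m < n) trunc (rev (mkseq kk r)) N m / m%:R ^+ kk r.
  rewrite !big_nat; apply: eq_bigr => m hm; rewrite /coef /= mulrC IH //; lia.
case: eqP => k1; last first.
  by rewrite big1 ?add0r // => m _; rewrite /coef /= (introF eqP k1) mul0r mulr0.
rewrite k1 addrC; congr (_ + _).
(* The range [m <= n] fits into ['I_N] only for [n < N]. For [n = N] the ordinals stop at [N - 1],
   and the extra term of [trunc] vanishes since the inverse of 0 is 0. *)
have [nN'|nN'] := ltnP n N.
  rewrite (@sum_indicator N (fun m => (0 < m)%N && step (true, m) n)
     (fun m => coef 1 N (true, m) * chain_sum kk N r m) 1 n.+1) //.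
  rewrite !big_nat; apply: eq_bigr => m hm; rewrite /coef /= mulrC IH //; lia.
have -> : n = N by lia.
rewrite (@sum_indicator N (fun m => (0 < m)%N && step (true, m) N)
     (fun m => coef 1 N (true, m) * chain_sum kk N r m) 1 N) //; last first.
  by move=> m mN; rewrite /step /=; lia.
rewrite [RHS]big_nat_recr //= subnn invr0 mulr0 addr0.
rewrite !big_nat; apply: eq_bigr => m hm; rewrite /coef /= mulrC IH //; lia.
Qed.

(** The set [A] and the values merge into one function. For an allowed [A] the last position is
    unmarked, its entry being at least 2, so the bound at [n = N] reads [n_r < N] and holds for
    every ordinal. *)
Lemma zetaN_chain_sum k N : (1 < last 0%N k)%N ->
  zetaN k N = chain_sum (nth 0%N k) N (size k) N.
Proof.
move=> lk; rewrite /zetaN pair_big_dep /=.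
rewrite (reindex (fun h : {ffun 'I_(size k) -> bool * 'I_N} =>
   ([set i | (h i).1], [ffun i => (h i).2]))) /=; last first.
  exists (fun p : {set 'I_(size k)} * {ffun 'I_(size k) -> 'I_N} => [ffun i => (i \in p.1, p.2 i)]) => [h _|[A n] _] /=.
    by apply/ffunP => i; rewrite !ffunE inE; case: (h i).
  congr (_, _); first by apply/setP => i; rewrite inE ffunE.
  by apply/ffunP => i; rewrite !ffunE.
rewrite /chain_sum big_mkcond; apply: eq_bigr => h _.
case: (boolP (_ \subset _)) => /= [/subsetP sub|]; last first.
  move=> /subsetPn [i]; rewrite !inE => hi ki.
  by rewrite (bigD1 i) //= {1}/coef hi /= (negbTE ki) mul0r mulr0.
have -> : [forall i, 0 < [ffun i => (h i).2] i]%N &&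
   [forall i : 'I_(size k), forall j : 'I_(size k), (nat_of_ord j == i.+1) ==>
     (if i \in [set i | (h i).1] then ([ffun i => (h i).2] i <= [ffun i => (h i).2] j)%N
      else ([ffun i => (h i).2] i < [ffun i => (h i).2] j)%N)] = chain h N.
  rewrite /chain; congr (_ && _); first by apply: eq_forallb => i; rewrite ffunE.
  rewrite [X in _ = _ && X](_ : _ = true) ?andbT.
    apply: eq_forallb => i; apply: eq_forallb => j.
    by rewrite !ffunE inE.
  apply/forallP => i; apply/implyP => ei; rewrite /step /=.
  case: ifP => // hi; have := sub i; rewrite !inE hi => /(_ isT).
  have -> : nth 0%N k i = last 0%N k by move/eqP: (ei) => /(congr1 predn) /= ->; rewrite nth_last.
  by move=> /eqP e; rewrite e in lk.
case: ifP => _; last by rewrite mul0r.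
rewrite mul1r [RHS](bigID (fun i => i \in [set i | (h i).1])) /=; congr (_ * _).
  apply: eq_bigr => i hi; have := sub i hi; move: hi; rewrite !inE => hi ki.
  by rewrite /coef hi ki ffunE.
by apply: eq_bigr => i; rewrite inE /coef => /negbTE ->; rewrite ffunE.
Qed.

Lemma zetaN_trunc k N : (0 < N)%N -> (1 < last 0%N k)%N -> zetaN k N = trunc (rev k) N N.
Proof.
by move=> N0 lk; rewrite zetaN_chain_sum // chain_sum_trunc // mkseq_nth.
Qed.

(** * The basis and its cardinality *)

Lemma zeta_seq_trunc k m : admissible k -> zeta_seq k m = trunc (rev k) m.+1 m.+1.
Proof. by case/and3P=> _ _ lk; rewrite /zeta_seq zetaN_trunc. Qed.

Lemma admissible_Sspan k : admissible k -> Sspan (weight k) (fun N => trunc (rev k) N N).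
Proof.
case/and3P; rewrite /weight -sumn_rev -all_rev -[last _ _]/(last 0%N k).
case/lastP: k => // k a _; rewrite rev_rcons last_rcons => /andP[_ kp] a1.
exact: trunc_Sspan.
Qed.

Lemma in_I2_admissible w k : (1 < w)%N -> in_I2 w k -> admissible k.
Proof.
move=> w1 /andP[k2 /eqP kw]; apply/and3P; split.
- by apply: contraTneq w1 => k0; rewrite -kw k0.
- by apply: sub_all k2 => a /ltnW.
- case/lastP: k k2 kw => [|k a]; first by move=> _ /= e; lia.
  by rewrite all_rcons last_rcons => /andP[].
Qed.

Lemma in_I2_rev w k : in_I2 w (rev k) = in_I2 w k.
Proof. by rewrite /in_I2 all_rev sumn_rev. Qed.

Lemma sum_map_zeta_seq (L : seq (seq nat)) (c : seq nat -> rat) m :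
  \sum_(i < size (map zeta_seq L)) c (nth [::] L i) * nth (fun=> 0) (map zeta_seq L) i m
  = \sum_(k <- L) c k * zeta_seq k m.
Proof.
rewrite -(big_mkord xpredT (fun i => c (nth [::] L i) * nth (fun=> 0) (map zeta_seq L) i m)).
rewrite [RHS](big_nth [::]) size_map !big_nat; apply: eq_bigr => i /andP[_ iL].
by rewrite (nth_map [::]).
Qed.

Lemma Sspan_sum w (I : Type) (r : seq I) (P : pred I) (c : I -> rat) (f : I -> nat -> rat) :
  (forall i, P i -> Sspan w (f i)) -> Sspan w (fun N => \sum_(i <- r | P i) c i * f i N).
Proof.
move=> h; elim: r => [|i r IH].
  by apply: Sspan_ext (Sspan_0 w) => N _; rewrite big_nil.
case: (boolP (P i)) => Pi; last first.
  by apply: Sspan_ext IH => N _; rewrite big_cons (negbTE Pi).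
by apply: Sspan_ext (Sspan_add (Sspan_scale (c i) (h i Pi)) IH) => N _; rewrite big_cons Pi.
Qed.

(** The predecessor undoes the shift of [zeta_seq], whose entry [m] is the value at [N = m + 1]. *)
Lemma Zdiamond_Sspan w f : Zdiamond w f -> Sspan w (fun N => f N.-1).
Proof.
move=> [L [hL [c hc]]].
apply: (@Sspan_ext _ (fun N => \sum_(i < size (map zeta_seq L))
   c i * nth (fun=> 0) (map zeta_seq L) i N.-1)) => [N _|]; first exact: hc.
apply: Sspan_sum => i _; have iL : (i < size L)%N by rewrite -(size_map zeta_seq).
have /hL/andP[ka /eqP <-] := mem_nth [::] iL.
apply: Sspan_ext (admissible_Sspan ka) => -[|N] // _.
by rewrite (nth_map [::]) // zeta_seq_trunc.
Qed.

Lemma Sspan_coefs w g (L : seq (seq nat)) : uniq L -> (forall k, k \in L = in_I2 w k) ->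
  Sspan w g -> exists c : seq nat -> rat,
    forall N, (0 < N)%N -> g N = \sum_(k <- L) c k * trunc (rev k) N N.
Proof.
move=> uL hL hg; elim: hg hL => {w g}.
- move=> k k2 hL; exists (fun k' => (k' == rev k)%:R) => N _.
  have kL : rev k \in L by rewrite hL in_I2_rev /in_I2 k2 eqxx.
  rewrite (bigD1_seq (rev k)) //= eqxx revK mul1r big1 ?addr0 // => k' /negbTE ->.
  by rewrite mul0r.
- by move=> w _; exists (fun _ => 0) => N _; rewrite big1 // => k _; rewrite mul0r.
- move=> w f g _ hf _ hg hL; have [c hc] := hf hL; have [d hd] := hg hL.
  exists (fun k => c k + d k) => N N0; rewrite hc // hd // -big_split.
  by apply: eq_bigr => k _; rewrite mulrDl.
- move=> w a f _ hf hL; have [c hc] := hf hL.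
  exists (fun k => a * c k) => N N0; rewrite hc // mulr_sumr.
  by apply: eq_bigr => k _; rewrite mulrA.
- by move=> w f g h _ hf /hf [c hc]; exists c => N N0; rewrite h // hc.
Qed.

Lemma zeta_basis w (L : seq (seq nat)) : (1 < w)%N -> uniq L -> (forall k, k \in L = in_I2 w k) ->
  is_basis (map zeta_seq L) (Zdiamond w).
Proof.
move=> w1 uL hL; have adm k : k \in L -> admissible k by rewrite hL; apply: in_I2_admissible.
split.
- move=> i; have iL : (i < size L)%N by rewrite -(size_map zeta_seq).
  exists [:: nth [::] L i]; split.
    move=> k; rewrite inE => /eqP ->; have kL := mem_nth [::] iL.
    by rewrite adm //; move: kL; rewrite hL => /andP[].
  exists (fun _ => 1) => m; rewrite big_ord1 mul1r /= (nth_map [::]) //.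
- move=> c rel.
  (* [lin_indep] attaches coefficients to positions, [trunc_free] to indices. Uniqueness of the
     entries of [L] makes the translation well defined; the value off [L] is 0. *)
  pose c' k := if insub (index k L) is Some i then c i else 0.
  have c'E (i : 'I_(size (map zeta_seq L))) : c' (nth [::] L i) = c i.
    have iL : (i < size L)%N by rewrite -(size_map zeta_seq).
    by rewrite /c' index_uniq // valK.
  have rel' N : (0 < N)%N -> \sum_(k <- map rev L) c' (rev k) * trunc k N N = 0.
    case: N => // N _; rewrite big_map; apply: etrans (rel N).
    under [RHS]eq_bigr do rewrite -c'E.
    rewrite sum_map_zeta_seq !big_seq; apply: eq_bigr => k /adm ka.
    by rewrite revK zeta_seq_trunc.
  move=> i; have iL : (i < size L)%N by rewrite -(size_map zeta_seq).
  rewrite -c'E -(revK (nth [::] L i)).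
  apply: (trunc_free (w := w) (c := fun k => c' (rev k)) _ _ rel').
  + by rewrite map_inj_uniq //; apply: (can_inj revK).
  + by move=> _ /mapP [k kL ->]; rewrite in_I2_rev -hL.
  + by rewrite map_f // mem_nth.
- move=> f /Zdiamond_Sspan /(Sspan_coefs uL hL) [c hc].
  exists (fun i => c (nth [::] L i)) => m; rewrite sum_map_zeta_seq (hc m.+1) // !big_seq.
  by apply: eq_bigr => k /adm ka; rewrite zeta_seq_trunc.
Qed.

(** * Enumeration of the indices with entries at least 2 *)

Definition incr_head (k : seq nat) : seq nat := (head 0%N k).+1 :: behead k.

(** The Fibonacci recursion comes from the head: if it exceeds 2 it can be lowered by one, and if it
    equals 2 it can be removed. *)
Fixpoint I2enum (n : nat) : seq (seq nat) :=
  match n with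
  | 0 => [:: [::]]
  | 1 => [::]
  | (m.+1 as p).+1 => map incr_head (I2enum p) ++ map (cons 2%N) (I2enum m)
  end.

Lemma I2enumSS m : I2enum m.+2 = map incr_head (I2enum m.+1) ++ map (cons 2%N) (I2enum m).
Proof. by []. Qed.

Lemma size_I2enum n : size (I2enum n.+1) = fib n.
Proof.
elim/ltn_ind: n => -[|[|n]] IH //.
by rewrite I2enumSS size_cat !size_map !IH.
Qed.

Lemma mem_I2enum n k : (k \in I2enum n) = in_I2 n k.
Proof.
rewrite /in_I2; elim/ltn_ind: n k => -[|[|n]] IH k.
- rewrite inE; case: k => [|a k] //=; apply/esym/negbTE/negP => /andP[/andP[a2 _] /eqP kw]; move: a2; lia.
- rewrite in_nil; case: k => [|a k] //=; apply/esym/negbTE/negP => /andP[/andP[a2 _] /eqP kw]; move: a2; lia.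
rewrite I2enumSS mem_cat; apply/idP/idP.
  case/orP=> /mapP [k']; rewrite IH // => /andP[k2 /eqP kw] ->.
    case: k' k2 kw => [|a k'] //= /andP[a2 ->] kw; rewrite andbT /incr_head /=.
    by apply/andP; split; [exact: leqW | apply/eqP; lia].
  by rewrite /= k2 /=; apply/eqP; rewrite kw; lia.
case: k => [//|a k]; rewrite [all _ _]/= [sumn _]/= => /andP[/andP[a2 k2] /eqP kw].
have [a3|a3] := ltnP 2 a.
  apply/orP; left; apply/mapP; exists (a.-1 :: k); last by rewrite /incr_head /= prednK //; lia.
  by rewrite IH //= k2 andbT; move: kw => /= kw; apply/andP; split; [|apply/eqP]; lia.
have {}a2 : a = 2%N by apply/eqP; rewrite eqn_leq a3.
subst a; apply/orP; right; apply: map_f; rewrite IH // k2.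
by move: kw => /= kw; apply/eqP; lia.
Qed.

Lemma uniq_I2enum n : uniq (I2enum n).
Proof.
elim/ltn_ind: n => -[|[|n]] IH //.
rewrite I2enumSS cat_uniq; apply/and3P; split.
- rewrite map_inj_in_uniq ?IH // => k1 k2; rewrite !mem_I2enum.
  by case: k1 => [|a k1] // _; case: k2 => [|b k2] // _ [-> ->].
- apply/hasPn => _ /mapP [k _ ->]; apply/mapP => -[k']; rewrite mem_I2enum.
  by case: k' => [|a k'] //; case/andP=> /andP[a2 _] _ [e]; rewrite -e in a2.
- by rewrite map_inj_uniq ?IH // => k1 k2 [].
Qed.

Theorem mainTheorem6 (w : nat) (hw : (2 <= w)%N) :
  (forall L : seq (seq nat),
     uniq L -> (forall k, k \in L = in_I2 w k) ->
     is_basis (map zeta_seq L) (Zdiamond w)) /\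
  has_dim (Zdiamond w) (fib w.-1).
Proof.
split=> [L uL hL|]; first exact: zeta_basis.
exists (map zeta_seq (I2enum w)); split.
  by apply: zeta_basis; [|exact: uniq_I2enum|exact: mem_I2enum].
by rewrite size_map -size_I2enum prednK // ltnW.
Qed.
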